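(* Let $p=ab$ where $a>b$ are primes. If the complete tripartite graph $K_{p,p,1}$ is not $S$-determined, then $a=2b-1$, and the only complete tripartite graph not isomorphic to $K_{p,p,1}$ that has the same Seidel spectrum as $K_{p,p,1}$ is $K_{a^2,b,b}$.
   Context: All graphs are finite and simple. For a graph $G$, the Seidel matrix is $S(G)=J-I-2A(G)$, where $A(G)$ is the adjacency matrix, $J$ the all-ones matrix and $I$ the identity; its eigenvalue multiset is the Seidel spectrum of $G$. For a partition $V(G)=U\cup W$, Seidel switching with respect to $U$ deletes all edges between $U$ and $W$ and adds an edge between $u\in U$, $w\in W$ whenever $uw$ was not an edge. Two graphs are switching equivalent if one is obtained from the other by a Seidel switching. A graph $G$ is $S$-determined if every graph with the same Seidel spectrum as $G$ is switching equivalent to a graph isomorphic to $G$. *)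

(* Defs.v *)
From HB Require Import structures.
From mathcomp Require Import all_boot all_order all_algebra all_field.

Set Implicit Arguments.
Unset Strict Implicit.
Unset Printing Implicit Defensive.

Import GRing.Theory.
Local Open Scope ring_scope.

Record sgraph (T : finType) := SGraph {
  edge :> rel T;
  edge_sym : symmetric edge;
  edge_irrefl : irreflexive edge
}.

Definition isomorphic (T1 T2 : finType) (G : sgraph T1) (H : sgraph T2) : Prop :=
  exists2 f : T1 -> T2, bijective f & {mono f : x y / G x y >-> H x y}.

(* Rows and columns are indexed by the enumeration of the vertex type. *)
Definition adjacency_mx (T : finType) (G : sgraph T) : 'M[algC]_#|T| :=
  \matrix_(i, j) (G (enum_val i) (enum_val j))%:R.

Definition seidel_mx (T : finType) (G : sgraph T) : 'M[algC]_#|T| :=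
  const_mx 1 - 1%:M - 2%:R *: adjacency_mx G.

(* The eigenvalues counted with algebraic multiplicity: the sequence r with
   char_poly A = \prod_(z <- r) ('X - z%:P), unique up to perm_eq. *)
Definition eigenvalues (n : nat) (A : 'M[algC]_n) : seq algC :=
  sval (closed_field_poly_normal (char_poly A)).

Definition seidel_spectrum (T : finType) (G : sgraph T) : seq algC :=
  eigenvalues (seidel_mx G).

Definition same_seidel_spectrum (T1 T2 : finType)
    (G : sgraph T1) (H : sgraph T2) : Prop :=
  perm_eq (seidel_spectrum G) (seidel_spectrum H).

Section Switching.
Variables (T : finType) (G : sgraph T) (U : {set T}).

Definition switch_rel : rel T := fun x y =>
  if (x \in U) == (y \in U) then G x y else ~~ G x y.

Lemma switch_rel_sym : symmetric switch_rel.
Proof. by move=> x y; rewrite /switch_rel eq_sym edge_sym. Qed.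

Lemma switch_rel_irrefl : irreflexive switch_rel.
Proof. by move=> x; rewrite /switch_rel eqxx edge_irrefl. Qed.

Definition switch : sgraph T := SGraph switch_rel_sym switch_rel_irrefl.
End Switching.

(* U = set0 and U = setT are allowed, so G is switching equivalent to itself. *)
Definition switching_equivalent (T : finType) (G H : sgraph T) : Prop :=
  exists U : {set T}, H =2 switch G U.

Definition S_determined (T : finType) (G : sgraph T) : Prop :=
  forall (T' : finType) (H : sgraph T'), same_seidel_spectrum H G ->
  exists2 H' : sgraph T', switching_equivalent H H' & isomorphic H' G.

Definition complete_tripartite (T : finType) (G : sgraph T) : Prop :=
  exists2 c : T -> 'I_3,
    (forall k, exists v, c v = k) & (forall x y, G x y = (c x != c y)).

Section Tripartite.
Variables x y z : nat.

Definition tripartite_vertex : finType := ('I_x + 'I_y + 'I_z)%type.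

Definition tripartite_part (v : tripartite_vertex) : nat :=
  match v with
  | inl (inl _) => 0
  | inl (inr _) => 1
  | inr _ => 2
  end.

Definition tripartite_rel : rel tripartite_vertex := fun u v => tripartite_part u != tripartite_part v.

Lemma tripartite_rel_sym : symmetric tripartite_rel.
Proof. by move=> u v; rewrite /tripartite_rel eq_sym. Qed.

Lemma tripartite_rel_irrefl : irreflexive tripartite_rel.
Proof. by move=> u; rewrite /tripartite_rel eqxx. Qed.

(* K_{x,y,z}; complete tripartite in the sense above only if x, y, z > 0. *)
Definition Ktripartite : sgraph tripartite_vertex := SGraph tripartite_rel_sym tripartite_rel_irrefl.
End Tripartite.

(* Main.v *)
Require Import Defs.
From mathcomp Require Import all_boot all_order all_algebra all_field.
From mathcomp Require Import spectral perm ring zify.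

(** If [G] is a switching of a complete tripartite graph with part sizes
    [x, y, z] (possibly zero), then [S(G) + I] factors through a 3-dimensional
    space, and its characteristic polynomial is
    [t^(n-3) (t^3 - n t^2 + 4 x y z)] with [n = x + y + z]: the Seidel spectrum
    amounts to the pair [(x + y + z, x y z)].  Conversely, a graph with such a
    spectrum has [S + I] of rank at most 3, because [S] is real symmetric, and
    a symmetric matrix with entries 1 and -1, diagonal 1 and rank at most 3 is
    a switching of a complete tripartite one.  So everything reduces to solving
    [x + y + z = 2ab + 1], [x y z = a^2 b^2] for primes [a > b]. *)

Set Implicit Arguments.
Unset Strict Implicit.
Unset Printing Implicit Defensive.
Import Order.TTheory GRing.Theory Num.Theory.

(** * Determinants, characteristic polynomials and ranks *)

Section LinearAlgebra.
Local Open Scope ring_scope.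

(** Sylvester's determinant identity in a division-free form. Multiplying the block matrix with rows
    [y, P] and [Q, 1] by a triangular matrix on the right or on the left clears one off-diagonal
    block, so its determinant is computed in two ways. *)
Lemma det_sub_mulmxC (R : comNzRingType) (m n : nat) (y : R)
    (P : 'M[R]_(n, m)) (Q : 'M[R]_(m, n)) :
  y ^+ m * \det (y%:M - P *m Q) = y ^+ n * \det (y%:M - Q *m P).
Proof.
have E1 : block_mx y%:M P Q 1%:M *m block_mx 1%:M 0 (- Q) 1%:M
    = block_mx (y%:M - P *m Q) P 0 1%:M.
  rewrite mulmx_block !mulmx1 !mulmx0 !mulmxN mul1mx subrr add0r.
  by rewrite add0r.
have E2 : block_mx 1%:M 0 (- Q) y%:M *m block_mx y%:M P Q 1%:M
    = block_mx y%:M P 0 (y%:M - Q *m P).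
  rewrite mulmx_block !mul1mx !mul0mx !addr0 mulmx1 !mulNmx.
  by rewrite scalar_mxC addNr (addrC _ y%:M).
have D1 := congr1 determinant E1; have D2 := congr1 determinant E2.
rewrite det_mulmx det_lblock det_ublock !det1 !mulr1 in D1.
rewrite det_mulmx det_lblock det_ublock det1 mul1r !det_scalar D1 in D2.
exact: D2.
Qed.

Lemma char_poly_eigenvalues (n : nat) (A : 'M[algC]_n) :
  char_poly A = \prod_(z <- eigenvalues A) ('X - z%:P).
Proof.
rewrite /eigenvalues; case: closed_field_poly_normal => r /= Er.
by rewrite {1}Er (monicP (char_poly_monic A)) scale1r.
Qed.

Lemma perm_eigenvaluesE (m n : nat) (A : 'M[algC]_m) (B : 'M[algC]_n) :
  perm_eq (eigenvalues A) (eigenvalues B) <-> char_poly A = char_poly B.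
Proof.
rewrite !char_poly_eigenvalues; split=> [E|]; first exact: perm_big.
exact: prod_XsubC_eq.
Qed.

Lemma mxrank_diag_le (F : fieldType) (n : nat) (d : 'rV[F]_n) :
  (\rank (diag_mx d) <= #|[set i | (d 0 i != 0)%R]|)%N.
Proof.
have -> : diag_mx d = \sum_(i in [set i | d 0 i != 0]) d 0 i *: delta_mx i i.
  rewrite diag_mx_sum_delta [LHS](bigID (fun i => d 0 i != 0)) /=.
  rewrite [X in _ + X]big1 ?addr0 => [|i /negbNE/eqP->]; last by rewrite scale0r.
  by apply: eq_bigl => i; rewrite inE.
rewrite -sum1_card.
elim/big_rec2: _ => [|i A k _ IH]; first by rewrite mxrank0.
apply: leq_trans (mxrank_add _ _) _; rewrite leq_add //.
apply: leq_trans (mxrank_scale _ _) _; by rewrite mxrank_delta.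
Qed.

(** A normal matrix is unitarily diagonalisable, so the rank of [A - z] is bounded by the number of
    diagonal entries other than [z]. The divisibility says that [z] has multiplicity at least
    [n - k], without truncated subtraction. *)
Lemma mxrank_sub_eigenvalue (n k : nat) (A : 'M[algC]_n) (z : algC) :
  A \is normalmx -> (('X - z%:P) ^+ n %| ('X - z%:P) ^+ k * char_poly A) ->
  (\rank (A - z%:M)%R <= k)%N.
Proof.
move=> /orthomx_spectralP; set U := spectralmx A; set d := spectral_diag A.
move=> EA; have Uu : U \in unitmx by rewrite unitarymx_unit ?spectral_unitarymx.
have -> : A - z%:M = invmx U *m diag_mx (d - const_mx z) *m U.
  rewrite linearB /= diag_const_mx mulmxBr mulmxBl -EA; congr (_ - _).
  by rewrite scalar_mxC -mulmxA mulVmx // mulmx1.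
move=> dvd_chi; apply: leq_trans (mxrankM_maxl _ _) _.
apply: leq_trans (mxrankM_maxr _ _) _; apply: leq_trans (mxrank_diag_le _) _.
have chiE : char_poly A = \prod_(x <- [seq d 0 i | i <- enum 'I_n]) ('X - x%:P).
  have -> : char_poly A = char_poly (diag_mx d).
    rewrite {1}EA /char_poly.
    have EU : char_poly_mx (invmx U *m diag_mx d *m U) =
        map_mx polyC (invmx U) *m char_poly_mx (diag_mx d) *m map_mx polyC U.
      rewrite /char_poly_mx mulmxBr mulmxBl -!map_mxM; congr (_ - _).
      by rewrite scalar_mxC -mulmxA -map_mxM mulVmx // map_mx1 mulmx1.
    rewrite EU !det_mulmx mulrAC -det_mulmx -map_mxM mulVmx //.
    by rewrite map_mx1 det1 mul1r.
  rewrite char_poly_trig ?diag_mx_is_trig //.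
  by rewrite big_map big_enum; apply: eq_bigr => i _; rewrite mxE eqxx mulr1n.
have Y0 : ('X - z%:P) ^+ k != 0 by rewrite expf_neq0 ?polyXsubC_eq0.
have chi0 := monic_neq0 (char_poly_monic A).
move: dvd_chi; rewrite -mup_geq ?mulf_neq0 // mupM // mup_XsubCX eqxx chiE.
rewrite mu_prod_XsubC count_map; pose P i := d 0 i == z.
rewrite (eq_count (_ : _ =1 P)) // => n_le.
have -> : #|[set i | (d - const_mx z) 0 i != 0]| = count (predC P) (enum 'I_n).
  rewrite cardE -size_filter {1}/enum_mem -enumT; congr size.
  by apply: eq_filter => i /=; rewrite !inE !mxE subr_eq0.
have := count_predC P (enum 'I_n); rewrite size_enum_ord; lia.
Qed.

End LinearAlgebra.

(** * Switchings of complete tripartite graphs and their part sizes *)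

Definition switched_tripartite (T : finType) (G : sgraph T)
    (s : T -> bool) (c : T -> 'I_3) : Prop :=
  forall u v, G u v = s u (+) s v (+) (c u != c v).

Definition part_size (T : finType) (c : T -> 'I_3) (k : 'I_3) : nat :=
  #|[set v | c v == k]|.

Lemma sum_part_size (T : finType) (c : T -> 'I_3) :
  \sum_k part_size c k = #|T|.
Proof.
rewrite -sum1_card (partition_big c xpredT) //=.
by apply: eq_bigr => k _; rewrite /part_size -sum1dep_card.
Qed.

(** Indexing by [inord] of numerals gives equal entries syntactically equal names, as [ring]
    requires. *)
Lemma det_mx33 (R : comNzRingType) (A : 'M[R]_3) :
  let F i j := A (inord i) (inord j) in
  (\det A = F 0%N 0%N * (F 1%N 1%N * F 2%N 2%N - F 1%N 2%N * F 2%N 1%N)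
    - F 0%N 1%N * (F 1%N 0%N * F 2%N 2%N - F 1%N 2%N * F 2%N 0%N)
    + F 0%N 2%N * (F 1%N 0%N * F 2%N 1%N - F 1%N 1%N * F 2%N 0%N))%R.
Proof.
move=> F; have AE i j : A i j = F i j by rewrite /F !inord_val.
rewrite (expand_det_row _ ord0) !big_ord_recl big_ord0 /cofactor.
rewrite !(expand_det_row _ ord0) !big_ord_recl !big_ord0 /cofactor !det_mx11.
by rewrite !mxE !AE /=; ring.
Qed.

(** * Characteristic polynomial and rank of the Seidel matrix *)

Section SeidelSpectrum.
Local Open Scope ring_scope.
Variables (T : finType) (G : sgraph T).

Lemma seidel_mx_addE i j :
  (seidel_mx G - (-1)%:M) i j = (-1) ^+ G (enum_val i) (enum_val j).
Proof.
rewrite !mxE mulNrn opprK.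
have [->|_] := eqVneq i j; first by rewrite edge_irrefl /=; ring.
by case: (G _ _) => /=; ring.
Qed.

Lemma seidel_mx_normal : seidel_mx G \is normalmx.
Proof.
apply: symmetric_normalmx.
  apply/is_hermitianmxP; rewrite expr0 scale1r map_mx_id //.
  apply/matrixP => i j; rewrite !mxE eq_sym; congr (_ - _ - _ * _).
  by rewrite edge_sym.
apply/mxOverP => i j; rewrite !mxE.
by rewrite !(rpredB, rpredM, rpred1, rpred_nat).
Qed.

(** With [Y = X + 1] the characteristic polynomial is [det (Y - (S + I))], and [S + I = P Q] passes
    through dimension 3. Sylvester's identity reduces it to the 3 by 3 determinant of [Y - Q P]; the
    2 by 2 principal minors of [Q P] vanish, so there is no linear term in [Y]. *)
Lemma char_poly_switched_tripartite (s : T -> bool) (c : T -> 'I_3) :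
  switched_tripartite G s c ->
  ('X - (-1)%:P) ^+ 3 * char_poly (seidel_mx G) =
  ('X - (-1)%:P) ^+ #|T| * (('X - (-1)%:P) ^+ 3
    - #|T|%:R * ('X - (-1)%:P) ^+ 2 + (4 * \prod_k part_size c k)%:R).
Proof.
move=> Gsc; set Y := 'X - _.
pose P : 'M[{poly algC}]_(#|T|, 3) :=
  \matrix_(i, k) ((-1) ^+ s (enum_val i) * (c (enum_val i) == k)%:R).
pose Q : 'M[{poly algC}]_(3, #|T|) :=
  \matrix_(k, j) ((-1) ^+ s (enum_val j) * (-1) ^+ (k != c (enum_val j))).
have -> : char_poly (seidel_mx G) = \det (Y%:M - P *m Q).
  rewrite /char_poly; congr (\det _).
  have -> : char_poly_mx (seidel_mx G) =
      Y%:M - map_mx polyC (seidel_mx G - (-1)%:M).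
    by rewrite map_mxB map_scalar_mx /= raddfB /= opprB addrA subrK.
  congr (_ - _); apply/matrixP => i j.
  rewrite [LHS]mxE seidel_mx_addE Gsc !signr_addb.
  rewrite !rmorphM !rmorphXn rmorphN1 [RHS]mxE.
  rewrite (bigD1 (c (enum_val i))) //= big1 => [|k /negbTE nk]; rewrite !mxE.
    by rewrite eqxx mulr1 addr0 mulrA.
  by rewrite eq_sym nk mulr0 mul0r.
rewrite det_sub_mulmxC; congr (_ * _).
(* The switching signs occur squared here, so the spectrum depends on the part sizes alone. *)
have QPE k l : (Q *m P) k l = (-1) ^+ (k != l) * (part_size c l)%:R.
  rewrite mxE /part_size -sum1dep_card natr_sum mulr_sumr [RHS]big_mkcond /=.
  rewrite [RHS](reindex (@enum_val T T)) /=; last exact/onW_bij/enum_val_bij.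
  apply: eq_bigr => i _; rewrite !mxE; case: (c (enum_val i) =P l) => [->|_].
    by rewrite !mulr1 mulrAC -signr_addb addbb mul1r.
  by rewrite !mulr0.
move: (Q *m P) QPE => B BE; rewrite -(sum_part_size c).
pose w i := part_size c (inord i); have wE k : part_size c k = w k.
  by rewrite /w inord_val.
rewrite det_mx33 !mxE !BE !wE !big_ord_recl !big_ord0 /= -!val_eqE /=.
by rewrite !inordK // !wE /bump /= !natrM !natrD; ring.
Qed.

Lemma seidel_rows_dependent (y0 y1 y2 y3 : T) :
  (\rank (seidel_mx G - (-1)%:M)%R <= 3)%N ->
  exists l0 l1 l2 l3 : algC, [|| l0 != 0, l1 != 0, l2 != 0 | l3 != 0] /\
    forall x, l0 * (-1) ^+ G y0 x + l1 * (-1) ^+ G y1 x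
      + l2 * (-1) ^+ G y2 x + l3 * (-1) ^+ G y3 x = 0.
Proof.
set M := _ - _ => rkM; pose y (i : 'I_4) := nth y3 [:: y0; y1; y2] i.
pose A := rowsub (fun i => enum_rank (y i)) M.
have : ~~ row_free A.
  by rewrite -row_leq_rank -ltnNge ltnS (leq_trans _ rkM) // mxrankS // rowsub_sub.
rewrite -kermx_eq0 => /rowV0Pn[l /sub_kermxP lA l0].
pose L i := l 0 (inord i); have LE i : l 0 i = L i by rewrite /L inord_val.
exists (L 0%N), (L 1%N), (L 2%N), (L 3%N); split.
  apply: contraNT l0; rewrite !negb_or !negbK.
  move=> /and4P[/eqP L0 /eqP L1 /eqP L2 /eqP L3].
  apply/eqP/rowP => i; rewrite LE [RHS]mxE.
  by case: i => [[|[|[|[|]]]] /=].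
move=> x; have /rowP/(_ (enum_rank x)) := lA; rewrite [RHS]mxE mxE => <-.
rewrite !big_ord_recl big_ord0 addr0 !addrA !LE ![A _ _]mxE !seidel_mx_addE.
by rewrite !enum_rankK.
Qed.

Lemma mxrank_switched_tripartite :
  (\rank (seidel_mx G - (-1)%:M)%R <= 3)%N ->
  exists s c, switched_tripartite G s c.
Proof.
move=> rk3; have [o _|T0] := pickP {: T}; last first.
  by exists (fun=> false), (fun=> ord0) => u; have := T0 u.
(* [N] is the switching of [G] that isolates [o]. *)
pose N u v := G o u (+) G o v (+) G u v.
have No v : N o v = false by rewrite /N edge_irrefl addbb.
have Nsym u v : N u v = N v u by rewrite /N (edge_sym G u v) (addbC (G o u)).
have Nrefl u : N u u = false by rewrite /N edge_irrefl addbb.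
have [/existsP[u /existsP[v Nuv]]|/existsPn N0] := boolP [exists u, exists v, N u v];
  last first.
  exists (G o), (fun=> ord0) => u v; have /existsPn/(_ v) := N0 u.
  by rewrite /N eqxx addbF; case: (G o u); case: (G o v); case: (G u v).
(* The rows of o, u, v are independent, so every row w is determined by its
   entries in the columns o, u, v. *)
have key w x : (2 * (-1) ^+ N w x == (-1) ^+ N u x + (-1) ^+ N v x
    + (-1) ^+ N u w * (1 - (-1) ^+ N v x)
    + (-1) ^+ N v w * (1 - (-1) ^+ N u x) :> int).
  have [l0 [l1 [l2 [l3 [nz_l lE]]]]] := seidel_rows_dependent o u v w rk3.
  pose m0 := l0; pose m1 := l1 * (-1) ^+ G o u.
  pose m2 := l2 * (-1) ^+ G o v; pose m3 := l3 * (-1) ^+ G o w.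
  have GE a z : (-1) ^+ G a z = (-1) ^+ G o a * (-1) ^+ G o z * (-1) ^+ N a z :> algC.
    by rewrite -!signr_addb /N addbA addbb.
  have mE z : m0 + m1 * (-1) ^+ N u z + m2 * (-1) ^+ N v z + m3 * (-1) ^+ N w z = 0.
    rewrite -[RHS](mulr0 ((-1) ^+ G o z)) -(lE z) (GE u z) (GE v z) (GE w z).
    by rewrite /m0 /m1 /m2 /m3; case: (G o z) => /=; ring.
  have := mE o; have := mE u; have := mE v; have := mE x.
  rewrite ![N _ o]Nsym !No !Nrefl [N v u]Nsym Nuv ![N w _]Nsym ![N x _]Nsym /=.
  rewrite !expr0 !expr1 !mulr1 => Ex Ev Eu Eo.
  (* Otherwise the relation would involve only the rows of [o], [u], [v], whose entries in the
     columns [o], [u], [v] form an invertible matrix. *)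
  have m3_neq0 : m3 != 0.
    apply/eqP => m3E; move: Ev Eu Eo; rewrite m3E !mul0r !addr0 => Ev Eu Eo.
    have m2E : m2 = 0.
      apply: (mulfI (x := 2)); first by rewrite pnatr_eq0.
      transitivity ((m0 + m1 + m2) - (m0 + m1 + m2 * -1)); first by ring.
      by rewrite Eo Eu; ring.
    have m1E : m1 = 0.
      apply: (mulfI (x := 2)); first by rewrite pnatr_eq0.
      transitivity ((m0 + m1 + m2) - (m0 + m1 * -1 + m2)); first by ring.
      by rewrite Eo Ev; ring.
    have m0E : m0 = 0 by rewrite -Eo m1E m2E !addr0.
    move: nz_l m1E m2E m3E => /or4P[] /negP nz /eqP E1 /eqP E2 /eqP E3; apply: nz.
    - exact/eqP.
    - by rewrite /m1 mulf_eq0 signr_eq0 orbF in E1.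
    - by rewrite /m2 mulf_eq0 signr_eq0 orbF in E2.
    - by rewrite /m3 mulf_eq0 signr_eq0 orbF in E3.
  rewrite -subr_eq0 -(intr_eq0 algC); apply/eqP/(mulfI m3_neq0); rewrite mulr0.
  rewrite !(rmorphB, rmorphD, rmorphM, rmorphXn, rmorphN1, rmorph1) /=.
  set g := (-1) ^+ N u x in Ex *; set d := (-1) ^+ N v x in Ex *.
  set Lx := (X in X = 0) in Ex; set Lv := (X in X = 0) in Ev.
  set Lu := (X in X = 0) in Eu; set Lo := (X in X = 0) in Eo.
  (* This combination of the four relations eliminates [m0], [m1] and [m2], leaving [m3] times the
     wanted identity. *)
  transitivity (2 * Lx - (Lu + Lv) - g * (Lo - Lv) - d * (Lo - Lu)).
    by rewrite /Lx /Lv /Lu /Lo; ring.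
  by rewrite Ex Ev Eu Eo; ring.
(* At [x = w] the identity of [key] becomes [(1 - g) (1 - d) = 0], where [g] and [d] are the signs
   of [N u w] and [N v w]. *)
have disj w : ~~ (N u w && N v w).
  by have := key w w; rewrite Nrefl; case: (N u w); case: (N v w).
pose c w : 'I_3 :=
  if N u w then @Ordinal 3 1 isT else if N v w then @Ordinal 3 2 isT else ord0.
(* By [key], [N] is complete bipartite between colours 1 and 2, with colour 0 isolated. Switching
   colour 0 makes it complete tripartite, and [G o] undoes the normalisation. *)
exists (fun w => G o w (+) ~~ (N u w || N v w)), c => w x.
have -> : G w x = G o w (+) G o x (+) N w x.
  by rewrite /N addbA addbb.
move: (key w x) (disj w) (disj x); rewrite /c.
case: (G o w); case: (G o x); case: (N u w); case: (N v w); case: (N u x);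
  by case: (N v x); case: (N w x).
Qed.

End SeidelSpectrum.

(** * Graphs cospectral with a switched tripartite graph *)

Section SameSpectrum.
Local Open Scope ring_scope.
Variables (T1 T2 : finType) (G1 : sgraph T1) (G2 : sgraph T2).

Lemma same_seidel_spectrumE :
  same_seidel_spectrum G1 G2 <->
  char_poly (seidel_mx G1) = char_poly (seidel_mx G2).
Proof. exact: perm_eigenvaluesE. Qed.

Lemma same_seidel_spectrum_card : same_seidel_spectrum G1 G2 -> #|T1| = #|T2|.
Proof.
move=> /same_seidel_spectrumE/(congr1 (size \o val)) /=.
by rewrite !size_char_poly => -[].
Qed.

Variables (s2 : T2 -> bool) (c2 : T2 -> 'I_3).
Hypothesis G2sc : switched_tripartite G2 s2 c2.

(** The eigenvalue -1 has multiplicity at least [n - 3], which bounds the rank of [S + I] by 3. *)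
Lemma same_seidel_spectrum_switched_tripartite :
  same_seidel_spectrum G1 G2 -> exists s c, switched_tripartite G1 s c.
Proof.
move=> ssp; apply/mxrank_switched_tripartite/mxrank_sub_eigenvalue.
  exact: seidel_mx_normal.
have /same_seidel_spectrumE -> := ssp; rewrite (char_poly_switched_tripartite G2sc).
by rewrite (same_seidel_spectrum_card ssp) dvdp_mulr.
Qed.

Lemma same_seidel_spectrum_tripartiteE s1 c1 : switched_tripartite G1 s1 c1 ->
  same_seidel_spectrum G1 G2 <->
  #|T1| = #|T2| /\ (\prod_k part_size c1 k = \prod_k part_size c2 k)%N.
Proof.
move=> G1sc; have E1 := char_poly_switched_tripartite G1sc.
have E2 := char_poly_switched_tripartite G2sc.
have Y0 n : ('X - (-1)%:P) ^+ n != 0 :> {poly algC}.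
  by rewrite expf_neq0 ?polyXsubC_eq0.
split=> [ssp|[cT cP]]; last first.
  by apply/same_seidel_spectrumE/(mulfI (Y0 3%N)); rewrite E1 E2 cT cP.
have cT := same_seidel_spectrum_card ssp; split=> //.
have /same_seidel_spectrumE Echi := ssp.
(* With equal vertex counts, the two cubics in [X + 1] can differ only in the constant term. *)
move: E1; rewrite Echi E2 cT => /(mulfI (Y0 _))/addrI.
by rewrite -!polyC_natr => /polyC_inj/eqP; rewrite eqr_nat eqn_pmul2l // => /eqP.
Qed.

End SameSpectrum.

(** * Part sizes and isomorphism *)

Definition part_sizes (T : finType) (c : T -> 'I_3) : 3.-tuple nat :=
  [tuple part_size c k | k < 3].

Lemma big_part_sizes (R : Type) (idx : R) (op : Monoid.com_law idx) (F : nat -> R)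
    (T : finType) (c : T -> 'I_3) :
  \big[op/idx]_(n <- part_sizes c) F n = \big[op/idx]_k F (part_size c k).
Proof. by rewrite big_map big_enum. Qed.

Lemma part_size_bijection (T1 T2 : finType) (c1 : T1 -> 'I_3) (c2 : T2 -> 'I_3) :
  part_size c1 =1 part_size c2 ->
  exists2 f : T1 -> T2, bijective f & forall v, c2 (f v) = c1 v.
Proof.
move=> Ec; pose F1 k := enum [set v | c1 v == k]; pose F2 k := enum [set v | c2 v == k].
have sF k : size (F1 k) = size (F2 k) by rewrite -!cardE; apply: Ec.
have idx v : index v (F1 (c1 v)) < size (F2 (c1 v)).
  by rewrite -sF index_mem mem_enum inE.
have cT : #|T1| = #|T2|.
  by rewrite -(sum_part_size c1) -(sum_part_size c2); apply: eq_bigr.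
have [o _|T0] := pickP {: T2}; last first.
  have T10 (v : T1) : False.
    have : 0 < #|T1| by apply/card_gt0P; exists v.
    by rewrite cT (eq_card0 T0).
  exists (fun v => match T10 v with end) => [|v]; last by case: (T10 v).
  by apply: inj_card_bij; rewrite ?cT // => v; case: (T10 v).
(* Each vertex goes to the vertex of the same rank in the class of the same colour. *)
pose f v := nth o (F2 (c1 v)) (index v (F1 (c1 v))).
have cf v : c2 (f v) = c1 v.
  by have := mem_nth o (idx v); rewrite mem_enum inE => /eqP.
exists f => //; apply: inj_card_bij; last by rewrite cT.
move=> u v fuv; have cuv : c1 u = c1 v by rewrite -!cf fuv.
move: fuv (idx u) (idx v); rewrite /f cuv => /eqP + iu iv.
rewrite nth_uniq ?enum_uniq // => /eqP.
by apply: (index_inj u (s := F1 (c1 v))); rewrite mem_enum inE ?cuv.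
Qed.

Lemma perm_part_sizes_isomorphic (T1 T2 : finType) (G1 : sgraph T1) (G2 : sgraph T2)
    (c1 : T1 -> 'I_3) (c2 : T2 -> 'I_3) :
  (forall u v, G1 u v = (c1 u != c1 v)) -> (forall u v, G2 u v = (c2 u != c2 v)) ->
  perm_eq (part_sizes c1) (part_sizes c2) -> isomorphic G1 G2.
Proof.
move=> G1c G2c /tuple_permP[pi Epi].
have Es k : part_size c1 k = part_size c2 (pi k).
  have /(congr1 (fun t : seq nat => nth 0 t k)) := Epi.
  by rewrite -!tnth_nth !tnth_mktuple.
have [|f bij_f cf] := @part_size_bijection T1 T2 (pi \o c1) c2.
  move=> k; rewrite -[k](permKV pi) -Es; apply: eq_card => v.
  by rewrite !inE /= (inj_eq perm_inj).
by exists f => // u v; rewrite G2c !cf /= (inj_eq perm_inj) G1c.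
Qed.

Lemma isomorphic_part_sizes (T1 T2 : finType) (G1 : sgraph T1) (G2 : sgraph T2)
    (c2 : T2 -> 'I_3) :
  isomorphic G1 G2 -> (forall u v, G2 u v = (c2 u != c2 v)) ->
  exists2 c1 : T1 -> 'I_3, forall u v, G1 u v = (c1 u != c1 v) &
    part_sizes c1 = part_sizes c2.
Proof.
move=> [f bij_f f_mono] G2c; exists (c2 \o f) => [u v|]; first by rewrite -f_mono G2c.
apply: eq_mktuple => k; rewrite /part_size.
rewrite -(on_card_preimset (onW_bij _ bij_f)); apply: eq_card => v.
by rewrite !inE.
Qed.

(** Having a singleton part depends only on the partition into classes. This invariant separates
    [K_{p,p,1}] from [K_{a^2,b,b}]. *)
Lemma mem1_part_sizes (T : finType) (c c' : T -> 'I_3) :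
  (forall u v, (c u == c v) = (c' u == c' v)) ->
  1 \in tval (part_sizes c) -> 1 \in tval (part_sizes c').
Proof.
move=> Ecc' /mapP[k _ /esym/eqP/cards1P[v Ev]].
have /eqP cv : c v == k by have := set11 v; rewrite -Ev inE.
apply/mapP; exists (c' v); first by rewrite mem_enum.
apply/esym/eqP/cards1P; exists v; rewrite -Ev; apply/setP => u.
by rewrite !inE -Ecc' cv.
Qed.

Definition tripartite_color (x y z : nat) (v : tripartite_vertex x y z) : 'I_3 :=
  inord (tripartite_part v).

Lemma Ktripartite_color (x y z : nat) (u v : tripartite_vertex x y z) :
  Ktripartite x y z u v = (tripartite_color u != tripartite_color v).
Proof.
rewrite /= /tripartite_rel /tripartite_color -val_eqE /= !inordK //.
  by case: v => [[]|].
by case: u => [[]|].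
Qed.

Lemma part_sizes_Ktripartite (x y z : nat) :
  part_sizes (@tripartite_color x y z) = [:: x; y; z] :> seq nat.
Proof.
have Es k : part_size (@tripartite_color x y z) k = nth 0 [:: x; y; z] k.
  rewrite /part_size -sum1dep_card !big_sumType /= /tripartite_color /=.
  by case: k => [[|[|[|]]]] //= kP;
    rewrite -!val_eqE /= !inordK //= !big_pred0_eq ?sum1_card ?card_ord ?addn0.
apply: (@eq_from_nth _ 0) => [|i]; rewrite size_tuple // => i3.
by rewrite -(tnth_nth 0 _ (Ordinal i3)) tnth_mktuple Es.
Qed.

Lemma tripartite_switched (T : finType) (G : sgraph T) (c : T -> 'I_3) :
  (forall u v, G u v = (c u != c v)) -> switched_tripartite G (fun=> false) c.
Proof. by move=> Gc u v; rewrite Gc. Qed.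

(** * Arithmetic of the part sizes *)

Lemma prime_mul3 (a m x y z : nat) : prime a -> x * y * z = a * m ->
  exists x' y' z', x' * y' * z' = m /\
    [\/ [/\ x = a * x', y = y' & z = z'], [/\ x = x', y = a * y' & z = z'] |
        [/\ x = x', y = y' & z = a * z']].
Proof.
move=> pa E; have a0 := prime_gt0 pa.
have : a %| x * y * z by rewrite E dvdn_mulr.
rewrite !Euclid_dvdM // => /orP[/orP[]|] /dvdnP[k K]; subst.
- exists k, y, z; split; last by constructor 1; rewrite mulnC.
  by apply/eqP; rewrite -(eqn_pmul2l a0) -E; apply/eqP; lia.
- exists x, k, z; split; last by constructor 2; rewrite [k * a]mulnC.
  by apply/eqP; rewrite -(eqn_pmul2l a0) -E; apply/eqP; lia.
- exists x, y, k; split; last by constructor 3; rewrite [k * a]mulnC.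
  by apply/eqP; rewrite -(eqn_pmul2l a0) -E; apply/eqP; lia.
Qed.

(** The primes [a, a, b, b] are distributed among the three sizes in all 81 ways. Apart from
    [ab, ab, 1], a distribution with a part 1 has too large a sum ([H1] to [H4]); of the others,
    [ab, a, b] and [a, a, b^2] have too small a sum ([H5], [H6]), and [a^2, b, b] is left to
    [H7]. *)
Lemma tripartite_sizes (a b x y z : nat) : prime a -> prime b -> b < a ->
  x + y + z = 2 * (a * b) + 1 -> x * y * z = (a * b) ^ 2 ->
  perm_eq [:: x; y; z] [:: a * b; a * b; 1] \/
  a = 2 * b - 1 /\ perm_eq [:: x; y; z] [:: a ^ 2; b; b].
Proof.
move=> pa pb ba Es Ep; have b2 := prime_gt1 pb.
have [H1 H2 H3 H4] : [/\ 2 * (a * b) + 1 < (a * b) * (a * b) + 2,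
    2 * (a * b) < a * a + b * b, 2 * (a * b) < a * a * b + b &
    2 * (a * b) < a * b * b + a].
  (* Writing [b = 2 + e] and [a = b + 1 + d] turns the bounds into polynomial inequalities in free
     naturals. *)
  rewrite -(subnKC ba) -(subnKC b2); move: (b - 2) => e.
  by move: (a - _) => d; split; nia.
have [H5 H6] : a + b < a * b + 1 /\ 2 * a + b * b < 2 * (a * b) + 1.
  rewrite -(subnKC ba) -(subnKC b2); move: (b - 2) => e.
  by move: (a - _) => d; split; nia.
have H7 : a * a + 2 * b = 2 * (a * b) + 1 -> a = 2 * b - 1.
  (* The equation reads [a^2 - 1 = 2 b (a - 1)]; cancelling [a - 1] gives [a + 1 = 2 b]. *)
  by move=> E; have : (a - 1) * (a + 1) = (a - 1) * (2 * b); nia.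
have {}Ep : x * y * z = a * (a * (b * (b * 1))) by rewrite Ep; lia.
have [x1 [y1 [z1 [{}Ep E1]]]] := prime_mul3 pa Ep.
have [x2 [y2 [z2 [{}Ep E2]]]] := prime_mul3 pa Ep.
have [x3 [y3 [z3 [{}Ep E3]]]] := prime_mul3 pb Ep.
have [x4 [y4 [z4 [{}Ep E4]]]] := prime_mul3 pb Ep.
move/eqP: Ep; rewrite !muln_eq1 => /andP[/andP[/eqP x41 /eqP y41] /eqP z41].
subst x4 y4 z4; clear pa pb.
case: E4 => -[? ? ?]; subst; case: E3 => -[? ? ?]; subst;
case: E2 => -[? ? ?]; subst; case: E1 => -[? ? ?]; subst; rewrite ?muln1 in Es *;
first [exfalso; lia | left; apply/seq.permP => q /=; lia
  | right; split; [apply: H7; lia | rewrite -mulnn; apply/seq.permP => q /=; lia]].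
Qed.

(** * Cospectral mates of [K_{p,p,1}] *)

Lemma same_seidel_spectrum_KtripartiteE (T : finType) (G : sgraph T) s c (x y z : nat) :
  switched_tripartite G s c ->
  same_seidel_spectrum G (Ktripartite x y z) <->
  \sum_(n <- part_sizes c) n = x + y + z /\ \prod_(n <- part_sizes c) n = x * y * z.
Proof.
move=> Gsc; have KS := tripartite_switched (@Ktripartite_color x y z).
apply: iff_trans (same_seidel_spectrum_tripartiteE KS Gsc) _.
rewrite -(sum_part_size c) -(sum_part_size (@tripartite_color x y z)).
rewrite -!(big_part_sizes _ id) part_sizes_Ktripartite.
by rewrite !big_cons !big_nil /= muln1 addn0 mulnA addnA.
Qed.

Lemma part_sizes_same_spectrum (a b : nat) (T : finType) (G : sgraph T) s c :
  prime a -> prime b -> b < a -> switched_tripartite G s c ->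
  same_seidel_spectrum G (Ktripartite (a * b) (a * b) 1) ->
  perm_eq (part_sizes c) [:: a * b; a * b; 1] \/
  a = 2 * b - 1 /\ perm_eq (part_sizes c) [:: a ^ 2; b; b].
Proof.
move=> pa pb ba Gsc /(same_seidel_spectrum_KtripartiteE _ _ _ Gsc)[].
case: (part_sizes c) => [[|x [|y [|z []]]] //= _].
rewrite !big_cons !big_nil /= => Es Ep.
by apply: tripartite_sizes; rewrite // -?mulnn; lia.
Qed.

Theorem theorem4p7 (a b p : nat) (ha : prime a) (hb : prime b) (hab : b < a)
    (hp : p = a * b) (hnS : ~ S_determined (Ktripartite p p 1)) :
  a = 2 * b - 1 /\
  (forall (T : finType) (G : sgraph T), complete_tripartite G ->
     (~ isomorphic G (Ktripartite p p 1) /\ same_seidel_spectrum G (Ktripartite p p 1)) <->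
     isomorphic G (Ktripartite (a ^ 2) b b)).
Proof.
subst p.
have iso_K (T : finType) (G : sgraph T) c x y z : (forall u v, G u v = (c u != c v)) ->
    perm_eq (part_sizes c) [:: x; y; z] -> isomorphic G (Ktripartite x y z).
  move=> Gc; rewrite -(part_sizes_Ktripartite x y z).
  exact: perm_part_sizes_isomorphic (@Ktripartite_color x y z).
have aE : a = 2 * b - 1.
  (* If [a] differs from [2b - 1], every cospectral graph has part sizes [ab, ab, 1], and switching
     along [s] recovers [K_{p,p,1}]. *)
  apply/eqP/negP => /negP/eqP aN; apply: hnS => T' H ssp.
  have KS := tripartite_switched (@Ktripartite_color (a * b) (a * b) 1).
  have [s [c Hsc]] := same_seidel_spectrum_switched_tripartite KS ssp.
  have [Ec|[]//] := part_sizes_same_spectrum ha hb hab Hsc ssp.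
  exists (switch H [set v | s v]); first by exists [set v | s v].
  apply: iso_K Ec => u v; rewrite /= /switch_rel !inE Hsc.
  by case: (s u); case: (s v); case: (c u != c v).
split=> // T G [c _ Gc]; split=> [[nisoG ssp]|isoG].
  have [/(iso_K _ _ _ _ _ _ Gc)//|[_]] :=
    part_sizes_same_spectrum ha hb hab (tripartite_switched Gc) ssp.
  exact: iso_K.
have [d Gd Ed] := isomorphic_part_sizes isoG (@Ktripartite_color _ _ _).
split; last first.
  apply/(same_seidel_spectrum_KtripartiteE _ _ _ (tripartite_switched Gd)).
  rewrite Ed part_sizes_Ktripartite !big_cons !big_nil -mulnn.
  by have := prime_gt1 hb; split; nia.
(* The colourings [d] and [e] of [G] have the same classes, so an isomorphism with [K_{p,p,1}] would
   force 1 to be among [a^2, b, b]. *)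
move=> /isomorphic_part_sizes/(_ (@Ktripartite_color _ _ _))[e Ge Ee].
have : 1 \in tval (part_sizes d).
  apply: (@mem1_part_sizes _ e) => [u v|].
    by apply: negb_inj; rewrite -Ge -Gd.
  by rewrite Ee part_sizes_Ktripartite !inE eqxx !orbT.
rewrite Ed part_sizes_Ktripartite !inE.
by have := prime_gt1 ha; have := prime_gt1 hb; nia.
Qed.
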